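(* Let $p$ be a prime, let $n$ be a positive integer, and let $G = \mathbf{C}_n \rtimes \mathbf{C}_p$ be a semidirect product determined by an arbitrary homomorphism $\mathbf{C}_p \to \mathrm{Aut}(\mathbf{C}_n)$. Then $G$ is fully realizable if and only if $G$ is abelian and one of the following holds: $p = 2$ and $n \mid 12$, or $p = 3$ and $n \mid 4$.
   Context: Rings are associative with identity and ring homomorphisms preserve the identity. $R^\times$ is the group of units of a ring $R$; a ring endomorphism $\psi$ of $R$ restricts to a group endomorphism $\psi^\times$ of $R^\times$. A group $G$ is fully realizable if there is a ring $R$ with $R^\times = G$ (up to isomorphism) such that every group endomorphism of $G$ is of the form $\psi^\times$ for some ring endomorphism $\psi$ of $R$. $\mathbf{C}_m$ denotes the cyclic group of order $m$. *)

(* Defs.v *)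
From HB Require Import structures.
From mathcomp Require Import all_boot all_order all_algebra.
From mathcomp Require Import all_fingroup all_solvable.

Set Implicit Arguments.
Unset Strict Implicit.
Unset Printing Implicit Defensive.

Import GRing.Theory.

Section RingUnits.

Variable R : pzRingType.

(* A unit x is encoded as the pair (x, x^-1), the second component being
   determined by the first (ring_units_inj below).  This gives the unit group
   of an arbitrary ring, the zero ring included, without assuming that
   invertibility in R is decidable (as unitRingType does). *)
Definition inverse_pair (u : R * R) : bool :=
  ((u.1 * u.2 == 1) && (u.2 * u.1 == 1))%R.

Record ring_units : Type := RingUnit {
  ring_unit_pair :> R * R;
  ring_unit_pairP : inverse_pair ring_unit_pair
}.

HB.instance Definition _ := [isSub for ring_unit_pair].
HB.instance Definition _ := [Choice of ring_units by <:].

Implicit Types u v : ring_units.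

Lemma ring_unit_mulV u : (u.1 * u.2 = 1)%R.
Proof. by case/andP: (ring_unit_pairP u) => /eqP. Qed.

Lemma ring_unit_Vmul u : (u.2 * u.1 = 1)%R.
Proof. by case/andP: (ring_unit_pairP u) => _ /eqP. Qed.

Lemma ring_units_inj u v : u.1 = v.1 -> u = v.
Proof.
move=> eq_uv; apply: val_inj; rewrite /= (surjective_pairing u).
rewrite [RHS]surjective_pairing eq_uv; congr (_, _).
by rewrite -[LHS]mulr1 -(ring_unit_mulV v) mulrA -eq_uv ring_unit_Vmul mul1r.
Qed.

Lemma ring_unitsP (x : R) :
  (exists u : ring_units, u.1 = x) <-> exists y : R, (x * y = 1 /\ y * x = 1)%R.
Proof.
split=> [[u <-] | [y [xy yx]]].
  by exists u.2; rewrite ring_unit_mulV ring_unit_Vmul.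
have xyP : inverse_pair (x, y) by rewrite /inverse_pair /= xy yx eqxx.
by exists (RingUnit xyP).
Qed.

Fact ring_units_one_subproof : inverse_pair (1, 1)%R.
Proof. by rewrite /inverse_pair /= mulr1 eqxx. Qed.

Definition ring_units_one := RingUnit ring_units_one_subproof.

Fact ring_units_inv_subproof u : inverse_pair (u.2, u.1).
Proof. by rewrite /inverse_pair /= ring_unit_mulV ring_unit_Vmul eqxx. Qed.

Definition ring_units_inv u := RingUnit (ring_units_inv_subproof u).

Fact ring_units_mul_subproof u v : inverse_pair (u.1 * v.1, v.2 * u.2)%R.
Proof.
apply/andP; split; apply/eqP; rewrite /= mulrA.
  by rewrite -(mulrA u.1) ring_unit_mulV mulr1 ring_unit_mulV.
by rewrite -(mulrA v.2) ring_unit_Vmul mulr1 ring_unit_Vmul.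
Qed.

Definition ring_units_mul u v := RingUnit (ring_units_mul_subproof u v).

Fact ring_units_mulA : associative ring_units_mul.
Proof. by move=> u v w; apply: ring_units_inj; rewrite /= mulrA. Qed.

Fact ring_units_mul1 : left_id ring_units_one ring_units_mul.
Proof. by move=> u; apply: ring_units_inj; rewrite /= mul1r. Qed.

Fact ring_units_mulr1 : right_id ring_units_one ring_units_mul.
Proof. by move=> u; apply: ring_units_inj; rewrite /= mulr1. Qed.

Fact ring_units_mulV : left_inverse ring_units_one ring_units_inv ring_units_mul.
Proof. by move=> u; apply: ring_units_inj; rewrite /= ring_unit_Vmul. Qed.

Fact ring_units_mulrV :
  right_inverse ring_units_one ring_units_inv ring_units_mul.
Proof. by move=> u; apply: ring_units_inj; rewrite /= ring_unit_mulV. Qed.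

HB.instance Definition _ := isGroup.Build ring_units
  ring_units_mulA ring_units_mul1 ring_units_mulr1
  ring_units_mulV ring_units_mulrV.

End RingUnits.

Section UnitsMap.

Variables (R S : pzRingType) (psi : {rmorphism R -> S}).

Fact units_map_subproof (u : ring_units R) : inverse_pair (psi u.1, psi u.2).
Proof.
rewrite /inverse_pair /= -!rmorphM ring_unit_mulV ring_unit_Vmul.
by rewrite rmorph1 eqxx.
Qed.

Definition units_map (u : ring_units R) : ring_units S :=
  RingUnit (units_map_subproof u).

Fact units_map_is_multiplicative : {morph units_map : u v / (u * v)%g}.
Proof. by move=> u v; apply: ring_units_inj; rewrite /= rmorphM. Qed.

HB.instance Definition _ :=
  isMultiplicative.Build (ring_units R) (ring_units S) units_map
    units_map_is_multiplicative.

End UnitsMap.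

(* The isomorphism phi identifies G with the unit group of R. *)
Definition fully_realizable (G : groupType) : Prop :=
  exists (R : pzRingType) (phi : {multiplicative G -> ring_units R}),
    bijective phi /\
    forall f : {multiplicative G -> G},
      exists psi : {rmorphism R -> R},
        forall g : G, units_map psi (phi g) = phi (f g).

(* Main.v *)
Require Import Defs.
From HB Require Import structures.
From mathcomp Require Import all_boot all_order all_algebra.
From mathcomp Require Import all_fingroup all_solvable.
From mathcomp Require Import zify.

(* If every endomorphism of G = <a> ><| <b> lifts to R, the trivial one forces
   1 = -1 in R, and the projection to <b> shows that a unit built from a and b
   which it sends to 1 lies in <a>.  So if c is a power of a and d is odd and
   prime to the order of c, then 1 + c + ... + c^(d-1) is a power of a; comparing
   with its image under the inversion of <a> for d = 3 and d = 5 gives n | 12, and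
   likewise p | 12.  For p = 3 this makes the action trivial, and a unit of
   F_2[C_3 x C_3] excludes 3 | n.  For p = 2 a nontrivial action produces a
   dihedral subgroup <c, b> of order 8; the unit 1 + (1+c)(1+b) would then be a
   power of a, hence invariant under b |-> cb, which it is not.
   Conversely each of the groups is a product of C_2, C_2^2, C_4 or C_4 x C_2 with
   C_3 or 1, and these are realized by small rings of characteristic 2. *)

Set Implicit Arguments.
Unset Strict Implicit.
Unset Printing Implicit Defensive.

Import GRing.Theory.

Local Open Scope group_scope.

(** * Presentations of split metacyclic groups *)

(** Exponents are natural numbers, so the last clause encodes both the exact orders of [a] and [b]
    and the trivial intersection of the subgroups they generate. The boolean equality lets [xchoose]
    select a normal form. *)
Definition split_metacyclic (gT : groupType) (a b : gT) (n p k : nat) : Prop :=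
  [/\ a ^+ n = 1, b ^+ p = 1, a ^ b = a ^+ k,
      forall g, exists ji : nat * nat, g == b ^+ ji.1 * a ^+ ji.2 &
      forall j i, b ^+ j * a ^+ i = 1 -> p %| j /\ n %| i].

Lemma expg_mod_dvd (gT : groupType) (x : gT) m i j :
  0 < m -> x ^+ m = 1 -> i = j %[mod m] -> x ^+ i = x ^+ j.
Proof.
move=> m_gt0 xm1 eq_ij; rewrite (divn_eq i m) (divn_eq j m) eq_ij.
by rewrite !expgnDr ![(_ * m)%N]mulnC !expgnA !xm1 !expg1n.
Qed.

Lemma multiplicativeX (G H : groupType) (f : {multiplicative G -> H}) n :
  {morph f : x / x ^+ n}.
Proof.
move=> x; elim: n => [|n IHn]; last by rewrite !expgS gmulfM IHn.
by apply: (mulgI (f 1)); rewrite -gmulfM !mulg1.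
Qed.

Section Presentation.

Variables (gT : groupType) (a b : gT) (n p k : nat).
Hypotheses (n_gt0 : 0 < n) (p_gt0 : 0 < p).
Hypothesis gen_ab : split_metacyclic a b n p k.

Lemma split_metacyclic_inj j i j' i' :
  b ^+ j * a ^+ i = b ^+ j' * a ^+ i' -> j = j' %[mod p] /\ i = i' %[mod n].
Proof.
case: gen_ab => an1 bp1 _ _ disj eq_ba.
(* The shifts [p - j' %% p] and [n - i' %% n] are natural exponents giving the inverses of [b ^+ j']
   and [a ^+ i']. *)
have [] := disj (j + (p - j' %% p))%N ((n - i' %% n) + i)%N.
  have bV : b ^+ (p - j' %% p) = (b ^+ j')^-1.
    apply: (mulgI (b ^+ j')); rewrite mulgV -expgnDr -[RHS](expg0 b).
    apply: (expg_mod_dvd p_gt0 bp1).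
    by rewrite -modnDml subnKC ?modnn ?mod0n // ltnW ?ltn_mod.
  have aV : a ^+ (n - i' %% n) = (a ^+ i')^-1.
    apply: (mulgI (a ^+ i')); rewrite mulgV -expgnDr -[RHS](expg0 a).
    apply: (expg_mod_dvd n_gt0 an1).
    by rewrite -modnDml subnKC ?modnn ?mod0n // ltnW ?ltn_mod.
  rewrite addnC [X in a ^+ X]addnC !expgnDr aV bV -mulgA (mulgA (b ^+ j)) eq_ba.
  by rewrite -(mulgA (b ^+ j')) mulgV mulg1 mulVg.
have aux m x y : 0 < m -> m %| x + (m - y %% m) -> x = y %[mod m].
  move=> m_gt0 /eqP dv; apply/eqP; rewrite -(eqn_modDr (m - y %% m)) dv.
  by rewrite -modnDml subnKC ?modnn // ltnW ?ltn_mod.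
by rewrite [(_ + i)%N]addnC; split; exact: aux.
Qed.

Let ex_expo g : exists ji : nat * nat, g == b ^+ ji.1 * a ^+ ji.2.
Proof. by case: gen_ab. Qed.

Let expo (g : gT) : nat * nat := xchoose (ex_expo g).

Let expoP g : g = b ^+ (expo g).1 * a ^+ (expo g).2.
Proof. exact/eqP/(xchooseP (ex_expo g)). Qed.

Lemma conjgXX (hT : groupType) (x y : hT) i j :
  x ^ y = x ^+ k -> (x ^+ i) ^ (y ^+ j) = x ^+ (i * k ^ j).
Proof.
move=> xy; elim: j => [|j IHj]; first by rewrite muln1 conjg1.
by rewrite expgSr conjgM IHj conjXg xy -expgnA expnS mulnCA.
Qed.

(** A map is read off the chosen normal forms; uniqueness of exponents modulo [p] and [n] makes the
    choice harmless. The rule for multiplying two normal forms follows from [a ^ b = a ^+ k] alone,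
    so it is the same in both groups. *)
Lemma split_metacyclic_hom (hT : groupType) (x y : hT) :
    x ^+ n = 1 -> y ^+ p = 1 -> x ^ y = x ^+ k ->
  exists f : {multiplicative gT -> hT}, f a = x /\ f b = y.
Proof.
move=> xn1 yp1 xy; case: (gen_ab) => an1 bp1 ab _ _.
pose f g := y ^+ (expo g).1 * x ^+ (expo g).2.
have fE j i : f (b ^+ j * a ^+ i) = y ^+ j * x ^+ i.
  have [eq_j eq_i] := split_metacyclic_inj (esym (expoP (b ^+ j * a ^+ i))).
  congr (_ * _); first exact: expg_mod_dvd p_gt0 _ _.
  exact: expg_mod_dvd n_gt0 _ _.
have fM : {morph f : g h / g * h}.
  have mul_normal (K : groupType) (u v : K) j i j' i' : u ^ v = u ^+ k ->
      v ^+ j * u ^+ i * (v ^+ j' * u ^+ i')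
        = v ^+ (j + j') * u ^+ (i * k ^ j' + i').
    move=> uv; rewrite -mulgA (mulgA (u ^+ i)) (conjgC (u ^+ i)) (conjgXX _ _ uv).
    by rewrite !expgnDr !mulgA.
  move=> g h; rewrite {1}(expoP g) {1}(expoP h) (mul_normal _ _ _ _ _ _ _ ab).
  by rewrite fE -(mul_normal _ _ _ _ _ _ _ xy).
have fb : f b = y by have := fE 1%N 0%N; rewrite !mulg1.
have fa : f a = x by have := fE 0%N 1%N; rewrite !mul1g.
pose mixin := isMultiplicative.Build gT hT f fM.
pose F : {multiplicative gT -> hT} := HB.pack f mixin.
by exists F.
Qed.

Lemma split_metacyclic_hom_eq (hT : groupType)
    (f f' : {multiplicative gT -> hT}) :
  f a = f' a -> f b = f' b -> f =1 f'.
Proof.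
by move=> fa fb g; rewrite (expoP g) !gmulfM !multiplicativeX fa fb.
Qed.

Lemma split_metacyclic_abelian :
  (forall g h : gT, g * h = h * g) <-> a ^ b = a.
Proof.
split=> [cG | /conjg_fixP/commgP/commute_sym cba g h].
  by rewrite conjgE cG -mulgA mulgV mulg1.
have cpow j i j' i' : commute (b ^+ j * a ^+ i) (b ^+ j' * a ^+ i').
  have cb m m' : commute (b ^+ m) (b ^+ m') by exact: commuteX2.
  have ca m m' : commute (a ^+ m) (a ^+ m') by exact: commuteX2.
  have cba' m m' : commute (b ^+ m) (a ^+ m') by exact: commuteX2.
  apply: commuteM; apply: commute_sym; apply: commuteM => //.
  exact: commute_sym.
by rewrite (expoP g) (expoP h) (cpow _ _ _ _).
Qed.

End Presentation.

Lemma sdprod_by_split_metacyclic (p n : nat) (aT rT : finGroupType)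
    (P : {group aT}) (N : {group rT}) (to : groupAction P N) :
    cyclic P -> #|P| = p -> cyclic N -> #|N| = n ->
  exists (a b : sdprod_by to) (k : nat), split_metacyclic a b n p k.
Proof.
move=> /cyclicP[y defP] oP /cyclicP[x defN] oN.
have Py : y \in P by rewrite defP cycle_id.
have Nx : x \in N by rewrite defN cycle_id.
pose a := sdpair1 to x; pose b := sdpair2 to y.
have im1 : sdpair1 to @* N = <[a]> by rewrite -morphim_cycle // -defN.
have im2 : sdpair2 to @* P = <[b]> by rewrite -morphim_cycle // -defP.
have oa : #[a] = n by rewrite /order -im1 card_injm ?injm_sdpair1.
have ob : #[b] = p by rewrite /order -im2 card_injm ?injm_sdpair2.
have [_ mulab nab tiab] := sdprodP (sdprod_sdpair to).
rewrite im1 im2 in mulab nab tiab.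
have /cycleP[k abk] : a ^ b \in <[a]>.
  by rewrite memJ_norm ?cycle_id // (subsetP nab) ?cycle_id.
exists a, b, k; split=> //; rewrite -?oa -?ob ?expg_order //.
  move=> g; have : g \in <[b]> * <[a]> by rewrite (normC nab) mulab inE.
  by case/mulsgP=> _ _ /cycleP[j ->] /cycleP[i ->] ->; exists (j, i).
move=> j i ba1; rewrite !order_dvdn.
have bV : b ^+ j = (a ^+ i)^-1 by apply/eqP; rewrite -mulg_eq1 ba1.
have : b ^+ j \in <[a]> :&: <[b]>.
  by rewrite inE mem_cycle bV groupV mem_cycle.
rewrite tiab inE => /eqP b1; rewrite b1 eqxx; split=> //.
by rewrite b1 mul1g in ba1; rewrite ba1.
Qed.

(** * Geometric sums in characteristic two *)

Section CharacteristicTwo.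

Local Open Scope ring_scope.

Variable R : pzRingType.
Hypothesis two0 : 1 + 1 = 0 :> R.

Lemma addrr_two0 (x : R) : x + x = 0.
Proof. by rewrite -[x]mulr1 -mulrDr two0 mulr0. Qed.

Lemma oppr_two0 (x : R) : - x = x.
Proof. by apply/esym/eqP; rewrite -addr_eq0 addrr_two0. Qed.

Lemma addr_eq0_two0 (x y : R) : x + y = 0 -> x = y.
Proof. by move/eqP; rewrite addr_eq0 oppr_two0 => /eqP. Qed.

Lemma sqrrD_two0 (x y : R) : GRing.comm x y -> (x + y) ^+ 2 = x ^+ 2 + y ^+ 2.
Proof. move=> cxy; rewrite !expr2 mulrDl !mulrDr cxy -addrA (addrA (y * x)).
by rewrite addrr_two0 add0r. Qed.

Definition geom (d : nat) (x : R) : R := \sum_(i < d) x ^+ i.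

Lemma geomD i j x : geom (i + j) x = geom i x + x ^+ i * geom j x.
Proof.
rewrite /geom big_split_ord /= mulr_sumr; congr (_ + _).
by apply: eq_bigr => l _; rewrite exprD.
Qed.

Lemma geomS i x : geom i.+1 x = geom i x + x ^+ i.
Proof. exact: big_ord_recr. Qed.

(** Each exponent below [d * t] is uniquely [i + d * j] with [i < d] and [j < t]. *)
Lemma geomM d t x : geom (d * t) x = geom d x * geom t (x ^+ d).
Proof.
elim: t => [|t IHt]; first by rewrite muln0 /geom !big_ord0 mulr0.
rewrite mulnS addnC geomD IHt geomS mulrDr exprM; congr (_ + _).
by apply: commr_sum => i _; apply: commrX; apply/commr_sym/commrX/commrX.
Qed.

Lemma geom_comm d t x y : GRing.comm x y -> GRing.comm (geom d x) (geom t y).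
Proof.
move=> cxy; apply: commr_sum => j _; apply: commr_sym.
by apply: commr_sum => i _; apply/commr_sym/commrX/commr_sym/commrX/commr_sym.
Qed.

(* For [d t = 1 + 2 q m], the product [geom d x * geom t (x ^+ d)] telescopes to
   [geom (1 + 2 q m) x], which is [1] because each power occurs an even number of
   times except [x ^+ 0]. *)
Lemma geom_unit d m x :
    (0 < m)%N -> x ^+ m = 1 -> odd d -> coprime d m ->
  exists y, geom d x * y = 1 /\ y * geom d x = 1.
Proof.
move=> m_gt0 xm1 odd_d co_dm.
have d_gt0 : (0 < d)%N by case: d odd_d {co_dm}.
have /(coprimeP _ d_gt0)[[t q] /= tq] : coprime d (m + m).
  by rewrite addnn -muln2 coprimeMr co_dm coprimen2.
exists (geom t (x ^+ d)).
have -> : geom t (x ^+ d) * geom d x = geom d x * geom t (x ^+ d).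
  exact/geom_comm/commr_sym/commrX.
rewrite -geomM; suff -> : geom (d * t) x = 1 by [].
have -> : (d * t = q * m + q * m + 1)%N by lia.
have xqm : x ^+ (q * m) = 1 by rewrite mulnC exprM xm1 expr1n.
rewrite geomD geomD exprD xqm !mul1r addrr_two0 add0r.
by rewrite /geom big_ord1 expr0.
Qed.

(** Squaring is additive on commuting elements in characteristic two. *)
Lemma geom_sqr d x : geom d (x ^+ 2) = geom d x ^+ 2.
Proof.
elim: d => [|d IHd]; first by rewrite /geom !big_ord0 expr0n.
rewrite !geomS sqrrD_two0; last first.
  by apply/commr_sym/commr_sum => i _; apply/commrX/commr_sym/commrX.
by rewrite IHd -!exprM mulnC.
Qed.

(** Since [x ^+ d * y ^+ i = x ^+ (d - i)], multiplication by [x ^+ d] lists the powers of [x] in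
    reverse order. *)
Lemma geom_rev d x y : x * y = 1 -> x ^+ d * geom d.+1 y = geom d.+1 x.
Proof.
move=> xy1; have xyX i : x ^+ i * y ^+ i = 1.
  elim: i => [|i IHi]; first by rewrite mulr1.
  by rewrite exprSr exprS -mulrA (mulrA x) xy1 mul1r.
rewrite /geom mulr_sumr (reindex_inj rev_ord_inj); apply: eq_bigr => i _ /=.
have id : (i <= d)%N by rewrite -ltnS.
by rewrite subSS -{1}(subnKC id) exprD -mulrA xyX mulr1.
Qed.

(* If [1 + x + ... + x^d] is a power of [A] and [psi] inverts [A], then [psi]
   inverts this sum, and it also divides it by [x^d]. *)
Lemma geom_inverted (psi : {rmorphism R -> R}) A e d j :
    A * psi A = 1 -> psi A * A = 1 ->
    geom d.+1 (A ^+ e) = A ^+ j ->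
  geom d.+1 (A ^+ e ^+ 2) = A ^+ e ^+ d.
Proof.
move=> AB BA vA; rewrite geom_sqr vA.
have AXV i : A ^+ i * psi A ^+ i = 1 /\ psi A ^+ i * A ^+ i = 1.
  have cAB : GRing.comm A (psi A) by rewrite /GRing.comm AB BA.
  by rewrite -!exprMn_comm ?AB ?BA ?expr1n //; exact: commr_sym.
have [xy _] := AXV e; have := geom_rev d xy.
have -> : geom d.+1 (psi A ^+ e) = psi (A ^+ j).
  rewrite -vA /geom rmorph_sum; apply: eq_bigr => i _.
  by rewrite !rmorphXn.
rewrite vA rmorphXn => vE.
by rewrite expr2 -{1}vE -mulrA (proj2 (AXV j)) mulr1.
Qed.

Lemma geom3_period y : geom 3 y = y -> y ^+ 2 = 1.
Proof.
rewrite !geomS /geom big_ord0 add0r expr0 expr1 => /eqP.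
rewrite addrAC -subr_eq0 addrK => /eqP /addr_eq0_two0.
exact: esym.
Qed.

(** The hypothesis reads (1 + y)(1 + y^3) = 0, and multiplying by 1 + y + y^2 turns this product
    into (1 + y^3)^2 = 1 + y^6. *)
Lemma geom5_period y : geom 5 y = y ^+ 2 -> y ^+ 6 = 1.
Proof.
rewrite !geomS /geom big_ord0 add0r expr0 expr1 => y4.
have /(congr1 (fun z => (1 + y + y ^+ 2) * z)) : 1 + y + y ^+ 3 + y ^+ 4 = 0.
  apply/eqP; rewrite -(addrK (y ^+ 2) (1 + y + _ + _)) subr_eq0.
  by rewrite -[X in _ == X]y4 [X in X == _](ACl (1*2*5*3*4)).
rewrite mulr0 !mulrDl !mulrDr !mul1r !mulr1 -!expr2.
rewrite -?exprSr -?exprS -?exprD !addrA => y0.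
apply: addr_eq0_two0; rewrite -[RHS]y0.
rewrite [RHS](ACl ((12*1)*(2*5)*(3*10)*(4*7)*(6*9)*(8*11))) /=.
by rewrite !addrr_two0 !addr0.
Qed.

End CharacteristicTwo.

(** * Constraints on a realized group *)

Section Necessity.

Variables (gT : groupType) (a b : gT) (n p k : nat).
Hypotheses (n_gt0 : 0 < n) (p_prime : prime p).
Hypothesis gen_ab : split_metacyclic a b n p k.
Variables (R : pzRingType) (phi : {multiplicative gT -> ring_units R}).
Hypothesis phi_bij : bijective phi.
Hypothesis phi_lift : forall f : {multiplicative gT -> gT},
  exists psi : {rmorphism R -> R}, forall g, units_map psi (phi g) = phi (f g).

Local Open Scope ring_scope.

Let p_gt0 : (0 < p)%N := prime_gt0 p_prime.
Let an1 : (a ^+ n = 1)%g. Proof. by case: gen_ab. Qed.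
Let bp1 : (b ^+ p = 1)%g. Proof. by case: gen_ab. Qed.
Let ab : (a ^ b = a ^+ k)%g. Proof. by case: gen_ab. Qed.

Definition unit_val (g : gT) : R := (phi g).1.
Local Notation v := unit_val.
Local Notation A := (v a).
Local Notation B := (v b).

Let vM g h : v (g * h)%g = v g * v h.
Proof. by rewrite /v gmulfM. Qed.

Let v_inj : injective v.
Proof. by move=> g h /ring_units_inj /(bij_inj phi_bij). Qed.

Let vX g i : v (g ^+ i)%g = v g ^+ i.
Proof.
elim: i => [|i IHi]; last by rewrite expgS vM IHi exprS.
by rewrite /v multiplicativeX.
Qed.

Let v1 : v 1%g = 1. Proof. exact: (vX 1%g 0). Qed.

Let v_surj x y : x * y = 1 -> y * x = 1 -> exists j i, x = B ^+ j * A ^+ i.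
Proof.
move=> xy yx.
have /ring_unitsP[u <-] : exists y, x * y = 1 /\ y * x = 1 by exists y.
have [phi' _ phi'K] := phi_bij; case: gen_ab => _ _ _ /(_ (phi' u)) [[j i]] + _.
by move=> /eqP uE; exists j, i; rewrite -!vX -vM -[in LHS](phi'K u) uE.
Qed.

Let A_dvd i : A ^+ i = 1 -> (n %| i)%N.
Proof.
rewrite -vX -v1 => /v_inj ai1; case: gen_ab => _ _ _ _ /(_ 0%N i).
by rewrite mul1g => /(_ ai1) [].
Qed.

Let B_dvd i : B ^+ i = 1 -> (p %| i)%N.
Proof.
rewrite -vX -v1 => /v_inj bi1; case: gen_ab => _ _ _ _ /(_ i 0%N).
by rewrite mulg1 => /(_ bi1) [].
Qed.

Let A_n : A ^+ n = 1. Proof. by rewrite -vX an1 v1. Qed.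
Let B_p : B ^+ p = 1. Proof. by rewrite -vX bp1 v1. Qed.

(** This is how realizability gets used below: an endomorphism is prescribed on [a] and [b] subject
    to the three relations, then lifted to [R]. *)
Let lift_gens (x y : gT) :
    (x ^+ n = 1)%g -> (y ^+ p = 1)%g -> (x ^ y = x ^+ k)%g ->
  exists psi : {rmorphism R -> R}, psi A = v x /\ psi B = v y.
Proof.
move=> xn yp xy.
have [f [fa fb]] := split_metacyclic_hom n_gt0 p_gt0 gen_ab xn yp xy.
have [psi psiE] := phi_lift f; exists psi.
by rewrite /v -fa -fb -!psiE.
Qed.

(** The unit -1 is a word in [A] and [B], so the lift of the trivial endomorphism sends it to 1; as
    a ring morphism, the lift also fixes it. *)
Let two0 : 1 + 1 = 0 :> R.
Proof.
have [||| psi [psiA psiB]] := @lift_gens 1%g 1%g; rewrite ?expg1n ?conj1g //.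
have [||j [i uE]] := @v_surj (-1) (-1); rewrite ?mulrNN ?mulr1 //.
have := rmorphN1 psi; rewrite {1}uE rmorphM !rmorphXn psiA psiB v1 !expr1n mulr1.
by move=> {1}->; rewrite addNr.
Qed.

Let geom1 d : odd d -> geom d (1 : R) = 1.
Proof.
move=> odd_d; rewrite /geom; under eq_bigr do rewrite expr1n.
rewrite sumr_const card_ord -(odd_double_half d) odd_d -addnn.
by rewrite mulrnDr [X in _ + X]mulrnDr (addrr_two0 two0) addr0.
Qed.

(** Lift of the projection [a |-> 1], [b |-> b]: on a unit [B ^+ j * A ^+ i] it keeps only
    [B ^+ j]. *)
Let psi1P : exists psi : {rmorphism R -> R},
  [/\ psi A = 1, psi B = B,
      forall x y, x * y = 1 -> y * x = 1 -> psi x = 1 -> exists i, x = A ^+ i &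
      forall x y, x * y = 1 -> y * x = 1 -> psi x = x -> exists j, x = B ^+ j].
Proof.
have [||| psi [psiA psiB]] := @lift_gens 1%g b; rewrite ?expg1n ?conj1g //.
exists psi; rewrite psiA psiB v1; split=> // x y xy yx.
  have [j [i ->]] := v_surj xy yx.
  rewrite rmorphM !rmorphXn psiA psiB v1 expr1n mulr1 => ->.
  by exists i; rewrite mul1r.
have [j [i ->]] := v_surj xy yx.
rewrite rmorphM !rmorphXn psiA psiB v1 expr1n mulr1 => <-.
by exists j.
Qed.

Let inv_aP : exists psi : {rmorphism R -> R},
  [/\ A * psi A = 1, psi A * A = 1 & psi B = B].
Proof.
have [||| psi [psiA psiB]] := @lift_gens a^-1%g b.
- by rewrite expVgn an1 invg1.
- exact: bp1.
- by rewrite conjVg ab expVgn.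
by exists psi; rewrite psiA psiB -!vM mulgV mulVg v1.
Qed.

(** Common to [A] and [B]. Write [m = l * q] with [q] a power of 3 and [l] prime to 3; the
    three-term sum bounds [l] and the five-term sum bounds [q]. *)
Let dvd12 (C : R) m :
    (0 < m)%N -> C ^+ m = 1 -> (forall i, C ^+ i = 1 -> (m %| i)%N) ->
    (forall d e l, (0 < l)%N -> odd d.+1 -> coprime d.+1 l -> C ^+ e ^+ l = 1 ->
       geom d.+1 (C ^+ e ^+ 2) = C ^+ e ^+ d) ->
  (m %| 12)%N.
Proof.
move=> m_gt0 Cm Cdvd geomC.
have [l co3l mE] := pfactor_coprime (isT : prime 3) m_gt0.
set q := (3 ^ logn 3 m)%N in mE; have q_gt0 : (0 < q)%N by rewrite expn_gt0.
have l_gt0 : (0 < l)%N by move: m_gt0; rewrite mE muln_gt0 => /andP[].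
(* For [d = 2] the element [C ^+ q] has exponent [l], prime to 3, and [y = C ^+ (2 * q)] satisfies
   [geom 3 y = y]. *)
have : C ^+ (q * 4) = 1.
  rewrite (erefl : 4 = 2 * 2)%N mulnA !exprM; apply: (geom3_period two0).
  by apply: (geomC 2 q l) => //; rewrite -exprM mulnC -mE.
move=> /Cdvd; rewrite mE mulnC dvdn_pmul2l // => l4.
(* For [d = 4] the element [C ^+ l] has exponent [q], a power of 3 and so prime to 5, and
   [y = C ^+ (2 * l)] satisfies [geom 5 y = y ^+ 2]. *)
have : C ^+ (l * 12) = 1.
  rewrite (erefl : 12 = 2 * 6)%N mulnA !exprM; apply: (geom5_period two0).
  rewrite -[RHS]exprM.
  by apply: (geomC 4 l q) => //; rewrite ?coprimeXr // -exprM -mE.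
move=> /Cdvd; rewrite mE dvdn_pmul2l // => q12.
rewrite Gauss_dvd ?q12 ?andbT; first exact: dvdn_trans l4 _.
by rewrite /q coprimeXl.
Qed.

(** The projection sends a sum of oddly many powers of [A] to 1, so such a unit is a power of [A];
    the inversion of [a] then applies. *)
Let n_dvd12 : (n %| 12)%N.
Proof.
have [psi1 [psi1A _ ker1 _]] := psi1P; have [psi [AV VA _]] := inv_aP.
apply: (dvd12 n_gt0 A_n A_dvd) => d e l l_gt0 odd_d co_dl Ael.
have [y [xy yx]] := geom_unit two0 l_gt0 Ael odd_d co_dl.
have [|j geomA] := ker1 _ _ xy yx; last exact: (geom_inverted two0 AV VA geomA).
rewrite rmorph_sum /= -[RHS](geom1 odd_d); apply: eq_bigr => i _.
by rewrite !rmorphXn psi1A expr1n.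
Qed.

(** Here the projection fixes sums of powers of [B], so those that are units are powers of [B]; the
    inverting endomorphism is [a |-> 1], [b |-> b^-1]. *)
Let p_23 : p = 2 \/ p = 3.
Proof.
suff p12 : (p %| 12)%N.
  have : p \in primes 12 by rewrite mem_primes p_prime.
  by rewrite !inE => /orP[] /eqP; [left | right].
have [psi1 [_ psi1B _ fix1]] := psi1P.
have [||| psi [_ psiB]] := @lift_gens 1%g b^-1%g.
- by rewrite expg1n.
- by rewrite expVgn bp1 invg1.
- by rewrite conj1g expg1n.
have BV : B * psi B = 1 by rewrite psiB -vM mulgV v1.
have VB : psi B * B = 1 by rewrite psiB -vM mulVg v1.
apply: (dvd12 p_gt0 B_p B_dvd) => d e l l_gt0 odd_d co_dl Bel.
have [y [xy yx]] := geom_unit two0 l_gt0 Bel odd_d co_dl.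
have [|j geomB] := fix1 _ _ xy yx; last exact: (geom_inverted two0 BV VB geomB).
by rewrite rmorph_sum /=; apply: eq_bigr => i _; rewrite !rmorphXn psi1B.
Qed.

Let kp1 : k ^ p = 1 %[mod n].
Proof.
have := conjgXX 1 p ab; rewrite bp1 conjg1 mul1n -{1}[X in X = _]mulg1 => akp.
have /(split_metacyclic_inj n_gt0 p_gt0 gen_ab)[] :
    (b ^+ 0 * a ^+ (k ^ p) = b ^+ 0 * a ^+ 1)%g.
  by rewrite !mul1g -akp mulg1.
by [].
Qed.

Let CB_of_conj e f : (e * k = f %[mod n])%N -> A ^+ e * B = B * A ^+ f.
Proof.
move=> ekf; rewrite -!vX -!vM conjgC conjXg ab -expgnA mulnC.
by rewrite (expg_mod_dvd n_gt0 an1 ekf).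
Qed.

(** Units modulo a divisor of 12 have square 1, so one with cube 1 is trivial; the residues are
    enumerated. *)
Let k1_p3 : p = 3 -> k = 1 %[mod n].
Proof.
move=> p3.
have : all (fun m => all (fun l =>
    (l ^ 3 %% m == 1 %% m) ==> (l %% m == 1 %% m)) (iota 0 m))%N (divisors 12)
  by [].
move=> /allP/(_ n); rewrite -dvdn_divisors // => /(_ n_dvd12)/allP/(_ (k %% n)%N).
rewrite mem_iota add0n ltn_mod modnXm modn_mod.
by have := kp1; rewrite p3 => -> /(_ n_gt0)/implyP/(_ (eqxx _))/eqP.
Qed.

(** If 3 divides [n], then [C] and [B] generate C_3 x C_3, and the unit [e + F * B] goes to 1 under
    the projection, hence is a power of [A]. Comparison with the inversion of [a] gives [F = F * B],
    which a further endomorphism contradicts. *)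
Let p3_n_dvd4 : p = 3 -> (n %| 4)%N.
Proof.
move=> p3; have k1 := k1_p3 p3.
suff n3 : ~~ (3 %| n)%N.
  by rewrite -(@Gauss_dvdl _ 4 3) // coprime_sym prime_coprime.
apply/negP => /dvdnP[m nE].
have m_gt0 : (0 < m)%N by case: (m) nE n_gt0 => // ->.
pose C := A ^+ m; have C3 : C ^+ 3 = 1 by rewrite -exprM -nE.
have C4 : C ^+ 4 = C by rewrite exprSr C3 mul1r.
have B3 : B ^+ 3 = 1 by have := B_p; rewrite p3.
have CB : C * B = B * C by apply: CB_of_conj; rewrite -modnMmr k1 modnMmr muln1.
(* [F] is idempotent, so [1 + F + F * B] is a unit with inverse
   [1 + F + F * B ^+ 2]. *)
have [F FE] : exists F, F = C + C ^+ 2 by eexists.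
have FB : F * B = B * F by rewrite FE expr2 mulrDl mulrDr mulrA -CB -!mulrA CB.
have FF : F * F = F.
  rewrite -expr2 {1}FE (sqrrD_two0 two0); last exact: commrX.
  by rewrite -exprM C4 addrC FE.
have [e eE] : exists e, e = 1 + F by exists (1 + F).
have eF : e * F = 0 by rewrite eE mulrDl mul1r FF (addrr_two0 two0).
have Fe : F * e = 0 by rewrite eE mulrDr mulr1 FF (addrr_two0 two0).
have ee : e * e = e by rewrite {2}eE mulrDr mulr1 eF addr0.
have uu' i j : (i + j = 3)%N -> (e + F * B ^+ i) * (e + F * B ^+ j) = 1.
  move=> ij; have FBi l : F * B ^+ l = B ^+ l * F by apply: commrX.
  rewrite mulrDl !mulrDr ee (mulrA e) eF mul0r addr0 {1}FBi -(mulrA (B ^+ i)) Fe.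
  rewrite mulr0 add0r mulrA -(mulrA F) -FBi mulrA FF -mulrA -exprD ij B3 mulr1 eE.
  by rewrite -addrA (addrr_two0 two0) addr0.
have uE := uu' 1%N 2%N erefl; have u'E := uu' 2%N 1%N erefl.
have [psi1 [psi1A psi1B ker1 _]] := psi1P.
have [psi [AV VA psiB]] := inv_aP.
have psiF0 : psi1 F = 0.
  by rewrite FE rmorphD !rmorphXn psi1A !expr1n (addrr_two0 two0).
have [|i u_i] := ker1 _ _ uE u'E.
  by rewrite eE !rmorphD rmorph1 rmorphM psiF0 mul0r !addr0.
have psiC : psi C = C ^+ 2.
  have CV : psi C * C = 1.
    rewrite rmorphXn -exprMn_comm ?VA ?expr1n //.
    by rewrite /GRing.comm AV VA.
  by rewrite -[LHS]mulr1 -C3 exprS mulrA CV mul1r.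
have psiF : psi F = F by rewrite FE rmorphD rmorphXn psiC -exprM C4 addrC.
(* The inversion of [a] fixes this unit, because it swaps [C] and [C ^+ 2], but also inverts it as a
   power of [A]. *)
have u2 : (e + F * B ^+ 1) * (e + F * B ^+ 1) = 1.
  rewrite -{1}[e + _](_ : psi (e + F * B ^+ 1) = _); last first.
    by rewrite eE !rmorphD rmorph1 rmorphM psiF rmorphXn psiB.
  rewrite u_i rmorphXn -exprMn_comm ?VA ?expr1n //.
  by rewrite /GRing.comm AV VA.
have FFB : F = F * B.
  have : e + F * B ^+ 1 = e + F * B ^+ 2.
    by rewrite -[LHS]mulr1 -uE mulrA u2 mul1r.
  move=> /addrI /(congr1 (fun z => z * B ^+ 2)).
  by rewrite -!mulrA -!exprD B3 !mulr1.
(* Sending [b] to [a ^+ m] turns [F = F * B] into [F = F * C], whence [C = 1], although [A] has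
   order [3 * m]. *)
have [||| psi2 [psi2A psi2B]] := @lift_gens a (a ^+ m)%g.
- exact: an1.
- by rewrite p3 -expgnA -nE an1.
- rewrite conjgE -expgS expgSr mulKg -[LHS]expg1.
  exact: (expg_mod_dvd n_gt0 an1 (esym k1)).
have psi2C : psi2 C = C by rewrite rmorphXn psi2A.
have := congr1 psi2 FFB; rewrite FE rmorphM rmorphD rmorphXn psi2C psi2B vX -/C.
rewrite mulrDl -expr2 -exprSr C3 addrC => /addrI C1.
have := A_dvd C1; rewrite nE => /dvdn_leq; lia.
Qed.

(* The bicyclic unit [1 + (1+B)A(1+B)] is killed by the projection to <b>, so it is
   a power of [A] and commutes with [A]. *)
Let p2_sqr : p = 2 -> (2 * k = 2 %[mod n])%N.
Proof.
move=> p2; have B2 : B * B = 1 by have := B_p; rewrite p2 expr2.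
have [D DE] : exists D, D = A ^+ k by eexists.
have AD : A * D = D * A by rewrite DE; apply: commrX.
have AB : A * B = B * D by rewrite DE -(CB_of_conj (e := 1)) ?mul1n.
have DB : D * B = B * A.
  by rewrite -[LHS]mul1r -B2 -!mulrA (mulrA B D) -AB -mulrA B2 mulr1.
have Y2 : (1 + B) * (1 + B) = 0.
  by rewrite mulrDl mul1r mulrDr mulr1 B2 (addrC B) (addrr_two0 two0).
have [w wE] : exists w, w = (1 + B) * A * (1 + B) by eexists.
have w2 : w * w = 0.
  by rewrite wE -!mulrA (mulrA (1 + B) (1 + B)) Y2 mul0r !mulr0.
have u2 : (1 + w) * (1 + w) = 1.
  by rewrite mulrDl mul1r mulrDr mulr1 w2 addr0 -addrA (addrr_two0 two0) addr0.
have wAD : w = (A + D) * (1 + B).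
  rewrite wE mulrDl mul1r -DB mulrDr mulr1 !mulrDl -[D * B * B]mulrA B2 mulr1.
  by rewrite !mulrDr !mulr1 addrACA [D * B + D]addrC.
have [psi1 [psi1A psi1B ker1 _]] := psi1P.
have [|i ui] := ker1 _ _ u2 u2.
  rewrite rmorphD rmorph1 wE !rmorphM rmorphD rmorph1 psi1A psi1B mulr1 Y2.
  exact: addr0.
(* With [w = (A + D) * (1 + B)], commutation with [A] reduces to [(A + D) * A = (A + D) * D], that
   is [A ^+ 2 = D ^+ 2]. *)
have : A * (1 + w) = (1 + w) * A by rewrite ui; apply: commrX.
rewrite mulrDr mulrDl mulr1 mul1r => /addrI.
rewrite wAD mulrA [A * (A + D)](_ : _ = (A + D) * A); last first.
  by rewrite mulrDr mulrDl AD.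
rewrite -!mulrA [A * (1 + B)]mulrDr [(1 + B) * A]mulrDl mulr1 mul1r -DB !mulrDr.
move=> /addrI; rewrite !mulrA => /(congr1 (fun z => z * B)).
rewrite -!mulrA B2 !mulr1 !mulrDl -AD addrC => /addrI A2D2.
have /v_inj a2 : v (a ^+ (2 * k)) = v (a ^+ 2).
  by rewrite !vX mulnC exprM -DE !expr2.
have /(split_metacyclic_inj n_gt0 p_gt0 gen_ab)[] :
    (b ^+ 0 * a ^+ (2 * k) = b ^+ 0 * a ^+ 2)%g by rewrite a2.
by [].
Qed.

(** Enumeration leaves only [n = 4], [k = 3] and [n = 12], [k = 7] modulo [n]. In both cases
    [a ^+ 3] has order 4 and [b] inverts it. *)
Let p2_dihedral : p = 2 -> (a ^ b)%g <> a ->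
  [/\ 3 * k = 9 %[mod n] & ~~ (n %| 6)]%N.
Proof.
move=> p2 nab; have k2 := p2_sqr p2; have kk := kp1; rewrite p2 in kk.
have k1 : (k %% n != 1 %% n)%N.
  apply/eqP => k1; apply: nab; rewrite ab -[RHS]expg1.
  exact: expg_mod_dvd n_gt0 an1 k1.
have : all (fun m => all (fun l =>
    [&& l ^ 2 %% m == 1 %% m, 2 * l %% m == 2 %% m & l %% m != 1 %% m] ==>
    ((3 * l) %% m == 9 %% m) && ~~ (m %| 6)) (iota 0 m))%N (divisors 12) by [].
move=> /allP/(_ n); rewrite -dvdn_divisors // => /(_ n_dvd12)/allP/(_ (k %% n)%N).
rewrite mem_iota add0n ltn_mod modnXm !modnMmr modn_mod kk k2 k1 !eqxx /=.
by move=> /(_ n_gt0)/andP[/eqP].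
Qed.

Let p2_abelian : p = 2 -> (a ^ b)%g = a.
Proof.
move=> p2; apply/eqP/negP => /negP/eqP /(p2_dihedral p2)[k3 n6].
have B2 : B * B = 1 by have := B_p; rewrite p2 expr2.
have [C CE] : exists C, C = A ^+ 3 by eexists.
have C4 : C ^+ 4 = 1.
  case/dvdnP: n_dvd12 => m mE.
  by rewrite CE -exprM [(3 * 4)%N]mE mulnC exprM A_n expr1n.
have C2 : C ^+ 2 <> 1 by rewrite CE -exprM => /A_dvd; apply/negP.
have CB : C * B = B * C ^+ 3 by rewrite CE -exprM; exact: CB_of_conj.
have C3B : C ^+ 3 * B = B * C.
  (* Conjugation sends [A ^+ 9] to [A ^+ (9 * k)], and [9 * k] is congruent to [3 * 9 = 27]; then
     [A ^+ 27 = A ^+ 3] because [C ^+ 4 = 1]. *)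
  rewrite CE -exprM (CB_of_conj (f := 27)); last first.
    by rewrite (erefl : 9 = 3 * 3)%N -mulnA -modnMmr k3 modnMmr.
  by rewrite -[in RHS](mulr1 (A ^+ 3)) -(expr1n _ 2) -C4 CE -!exprM -exprD.
have [X XE] : exists X, X = 1 + C by eexists.
have [Y YE] : exists Y, Y = 1 + B by eexists.
have XC : GRing.comm C X by rewrite XE /GRing.comm mulrDl mulrDr mulr1 mul1r.
have X2 : X ^+ 2 = 1 + C ^+ 2.
  rewrite XE (sqrrD_two0 two0) ?expr1n //; exact: commr_sym (commr1 _).
have X4 : X ^+ 4 = 0.
  rewrite (exprM X 2 2) X2 (sqrrD_two0 two0) ?expr1n; last first.
    exact: commr_sym (commr1 _).
  by rewrite -exprM C4.
have Y2 : Y * Y = 0.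
  by rewrite YE mulrDl mul1r mulrDr mulr1 B2 (addrC B) (addrr_two0 two0).
(* Moving [Y] across [X] produces [X ^+ 2], so the cube of [X * Y] acquires a factor
   [X ^+ 4 = 0]. *)
have YXY : Y * X * Y = C * X ^+ 2 * Y.
  rewrite {1}XE mulrDr mulr1 mulrDl Y2 add0r X2 mulrDr mulr1 -exprS YE.
  rewrite [(1 + B) * C]mulrDl mul1r -C3B mulrDr mulr1 !mulrDl.
  rewrite -[C ^+ 3 * B * B]mulrA B2 !mulrDr !mulr1 addrACA.
  by rewrite [C ^+ 3 * B + _]addrC.
(* [V] is nilpotent, hence [1 + V] is a unit. *)
have [V VE] : exists V, V = X * Y by eexists.
have V3 : V * V * V = 0.
  have CX2 : C * X ^+ 2 = X ^+ 2 * C by apply: commrX.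
  have X22 : X ^+ 2 * X ^+ 2 = 0 by rewrite -exprD.
  move: (X ^+ 2) YXY CX2 X22 => Z YXY CZ ZZ.
  have -> : V * V * V = X * (Y * X * Y) * X * Y by rewrite VE !mulrA.
  have -> : X * (Y * X * Y) * X * Y = X * C * Z * (Y * X * Y).
    by rewrite {1}YXY !mulrA.
  by rewrite YXY CZ !mulrA -(mulrA _ Z Z) ZZ mulr0 !mul0r.
have uu' : (1 + V) * (1 + V + V * V) = 1.
  rewrite mulrDl mul1r !mulrDr mulr1 mulrA V3 addr0 -!addrA.
  by rewrite (addrCA (V * V)) (addrr_two0 two0) addr0 (addrr_two0 two0) addr0.
have u'u : (1 + V + V * V) * (1 + V) = 1.
  rewrite mulrDr mulr1 !mulrDl mul1r V3 addr0 -!addrA.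
  by rewrite (addrCA (V * V)) (addrr_two0 two0) addr0 (addrr_two0 two0) addr0.
have [psi1 [psi1A psi1B ker1 _]] := psi1P.
have [|i ui] := ker1 _ _ uu' u'u.
  rewrite rmorphD rmorph1 VE rmorphM XE rmorphD rmorph1 CE rmorphXn psi1A expr1n.
  by rewrite two0 mul0r addr0.
(* This endomorphism fixes the powers of [A], hence [1 + V]. It sends [B] to [C * B], so
   [X * C = X], which forces [C ^+ 2 = 1]. *)
have [||| psi [psiA psiB]] := @lift_gens a (a ^+ 3 * b)%g.
- exact: an1.
- apply: v_inj; rewrite p2 v1 vX vM vX -CE expr2 mulrA -(mulrA C B) -C3B.
  by rewrite mulrA -exprS C4 mul1r B2.
- rewrite conjgM; have -> : (a ^ (a ^+ 3))%g = a; last exact: ab.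
  exact/conjg_fixP/commgP/commuteX.
have : psi (1 + V) = 1 + V by rewrite ui rmorphXn psiA.
rewrite rmorphD rmorph1 => /addrI.
rewrite VE rmorphM XE YE !rmorphD !rmorph1 psiB.
have -> : psi C = C by rewrite CE rmorphXn psiA.
rewrite vM vX -CE -XE !mulrDr => /addrI /(congr1 (fun z => z * B)).
rewrite -!mulrA B2 !mulr1 XE mulrDl mul1r -expr2 addrC => /addIr.
exact: C2.
Qed.

Lemma realized_necessary :
  (a ^ b)%g = a /\ ((p = 2 /\ n %| 12) \/ (p = 3 /\ n %| 4))%N.
Proof.
have [p2 | p3] := p_23; split; [exact: p2_abelian | by left | | right].
  by rewrite ab -[RHS]expg1; exact: (expg_mod_dvd n_gt0 an1 (k1_p3 p3)).
by split=> //; exact: p3_n_dvd4.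
Qed.

End Necessity.

(** * Realization by commutative rings *)

Local Open Scope ring_scope.

(** Full realizability of C_n x C_p read inside a commutative ring: the first four clauses present
    the unit group with basis [A], [B], and the last lifts every choice of images of the basis. *)
Definition realizing (R : comPzRingType) (n p : nat) (A B : R) : Prop :=
  [/\ A ^+ n = 1, B ^+ p = 1,
      forall i j, A ^+ i * B ^+ j = 1 -> (n %| i)%N /\ (p %| j)%N,
      forall x y, x * y = 1 -> exists i j, x = A ^+ i * B ^+ j &
      forall x y, x ^+ n = 1 -> y ^+ p = 1 ->
        exists psi : {rmorphism R -> R}, psi A = x /\ psi B = y].

Lemma realizing_fully_realizable (gT : groupType) (a b : gT) n p k
    (R : comPzRingType) (A B : R) :
    (0 < n)%N -> (0 < p)%N -> split_metacyclic a b n p k -> (a ^ b)%g = a ->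
  realizing n p A B -> fully_realizable gT.
Proof.
move=> n_gt0 p_gt0 gen_ab aba [An Bp inj_AB surj_AB liftR].
have [an bp abk ex_ba _] := gen_ab.
have unit_of (x : R) m : (0 < m)%N -> x ^+ m = 1 ->
    exists u : ring_units R, u.1 = x.
  case: m => // m _ xm; apply/ring_unitsP; exists (x ^+ m).
  by rewrite -exprS -exprSr.
have [uA uAE] := unit_of _ _ n_gt0 An; have [uB uBE] := unit_of _ _ p_gt0 Bp.
have valX (u : ring_units R) i : (u ^+ i)%g.1 = u.1 ^+ i.
  by elim: i => [|i IHi]; rewrite ?expgS ?exprS //= IHi.
have uAn : (uA ^+ n = 1)%g by apply: ring_units_inj; rewrite valX uAE An.
have uBp : (uB ^+ p = 1)%g by apply: ring_units_inj; rewrite valX uBE Bp.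
have ucomm : (uA ^ uB = uA ^+ k)%g.
  have -> : (uA ^+ k = uA)%g.
    rewrite -[RHS]expg1; apply: (expg_mod_dvd n_gt0 uAn).
    have [] // := @split_metacyclic_inj _ a b n p k n_gt0 p_gt0 gen_ab 0 k 0 1.
    by rewrite -abk aba expg1.
  apply/conjg_fixP/commgP/ring_units_inj; exact: mulrC.
have [phi [phia phib]] := split_metacyclic_hom n_gt0 p_gt0 gen_ab uAn uBp ucomm.
have phiE j i : (phi (b ^+ j * a ^+ i)%g).1 = A ^+ i * B ^+ j.
  by rewrite gmulfM !multiplicativeX phia phib /= !valX uAE uBE mulrC.
have phi_surj u : exists g, phi g == u.
  have [i [j uE]] := surj_AB _ _ (ring_unit_mulV u).
  by exists (b ^+ j * a ^+ i)%g; apply/eqP/ring_units_inj; rewrite phiE uE.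
have phi_inj : injective phi.
  move=> g h gh; suff : (g * h^-1 = 1)%g.
    by move=> /(congr1 (fun z => z * h)%g); rewrite mulgVK mul1g.
  have : phi (g * h^-1)%g = 1%g.
    apply: (mulIg (phi h)); rewrite -gmulfM mulgVK mul1g; exact: gh.
  have [[j i] /= /eqP ->] := ex_ba (g * h^-1)%g.
  move=> /(congr1 (fun u : ring_units R => u.1)).
  rewrite phiE => /inj_AB[/dvdnP[q ->] /dvdnP[r ->]].
  by rewrite ![(_ * n)%N]mulnC ![(_ * p)%N]mulnC !expgnA an bp !expg1n mulg1.
exists R, phi; split.
  exists (fun u => xchoose (phi_surj u)) => [g | u].
    by apply: phi_inj; apply/eqP/(xchooseP (phi_surj (phi g))).
  exact/eqP/(xchooseP (phi_surj u)).
move=> f; have [||psi [psiA psiB]] := liftR (phi (f a)).1 (phi (f b)).1.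
(* Writing the identity as [a ^+ 0] lets [multiplicativeX] evaluate [phi (f 1)]. *)
- by rewrite -valX -!multiplicativeX an -(expg0 a) !multiplicativeX.
- by rewrite -valX -!multiplicativeX bp -(expg0 a) !multiplicativeX.
exists psi => g.
apply: (split_metacyclic_hom_eq gen_ab
  (f := units_map psi \o phi) (f' := phi \o f)) => /=.
  by apply: ring_units_inj; rewrite phia /= uAE psiA.
by apply: ring_units_inj; rewrite phib /= uBE psiB.
Qed.

Lemma expr_mod_dvd (R : pzRingType) (x : R) m i j :
  x ^+ m = 1 -> i = j %[mod m] -> x ^+ i = x ^+ j.
Proof. by move=> xm ij; rewrite -(expr_mod i xm) ij expr_mod. Qed.

Lemma expr_coprime (R : pzRingType) (x : R) m l :
  (0 < m)%N -> coprime m l -> x ^+ m = 1 -> x ^+ l = 1 -> x = 1.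
Proof.
move=> m_gt0 /(coprimeP _ m_gt0)[[u w] /= uw] xm xl.
have := expr_mod_dvd xm (erefl (u * m %% m)%N).
have uwE : (u * m = w * l + 1)%N by lia.
by rewrite {1}uwE exprD mulnC exprM xl expr1n mul1r mulnC exprM xm expr1n.
Qed.

Lemma realizingC (R : comPzRingType) n p (A B : R) :
  realizing n p A B -> realizing p n B A.
Proof.
case=> An Bp injAB surjAB liftAB; split=> // [i j | x y xy | x y xp yn].
- by rewrite mulrC => /injAB[].
- by have [i [j ->]] := surjAB _ _ xy; exists j, i; rewrite mulrC.
by have [psi []] := liftAB _ _ yn xp; exists psi.
Qed.

(** Units of [R] have exponent dividing [n * p], so [x ^+ n] is killed by both [p] and [q], which
    are coprime. *)
Lemma realizing_expr (R : comPzRingType) n p q (A B x : R) :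
    (0 < n)%N -> (0 < q)%N -> (0 < p)%N -> realizing n p A B ->
    coprime n q -> coprime p q -> x ^+ (n * q) = 1 ->
  x ^+ n = 1.
Proof.
move=> n_gt0 q_gt0 p_gt0 [An Bp _ surjAB _] co_nq co_pq xnq.
have [i [j xE]] : exists i j, x = A ^+ i * B ^+ j.
  apply: (surjAB x (x ^+ (n * q).-1)).
  by rewrite -exprS prednK // muln_gt0 n_gt0.
apply: (expr_coprime p_gt0 co_pq); last by rewrite -exprM.
rewrite -exprM xE exprMn -!exprM ![(i * _)%N]mulnC ![(j * _)%N]mulnC.
by rewrite -mulnA exprM An expr1n mul1r [(n * p)%N]mulnC -mulnA exprM Bp expr1n.
Qed.

Lemma pair_exprE (R S : pzRingType) (x : R * S) i : x ^+ i = (x.1 ^+ i, x.2 ^+ i).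
Proof. by elim: i => // i IHi; rewrite !exprS IHi. Qed.

Lemma pair_rmorphism (R S : pzRingType) (f : {rmorphism R -> R})
    (g : {rmorphism S -> S}) :
  exists h : {rmorphism (R * S)%type -> (R * S)%type},
    forall x, h x = (f x.1, g x.2).
Proof.
pose h (x : R * S) := (f x.1, g x.2).
have hB : zmod_morphism h by move=> x y; rewrite /h !rmorphB.
have hM : monoid_morphism h.
  by split=> [|x y]; rewrite /h ?rmorph1 // !rmorphM.
pose mB := GRing.isZmodMorphism.Build _ _ h hB.
pose mM := GRing.isMonoidMorphism.Build _ _ h hM.
pose H : {rmorphism (R * S)%type -> (R * S)%type} := HB.pack h mB mM.
by exists H.
Qed.

(** Exponents in the two factors are merged by the Chinese remainder theorem. By [realizing_expr],
    the components of prescribed images satisfy the exponent conditions of their own factor, so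
    lifts are built componentwise. *)
Lemma realizing_pair (R S : comPzRingType) n p n' p' (A B : R) (A' B' : S) :
    (0 < n)%N -> (0 < p)%N -> (0 < n')%N -> (0 < p')%N ->
    coprime (n * p) (n' * p') -> realizing n p A B -> realizing n' p' A' B' ->
  @realizing (R * S)%type (n * n') (p * p') (A, A') (B, B').
Proof.
move=> n_gt0 p_gt0 n'_gt0 p'_gt0; rewrite coprimeMl !coprimeMr.
move=> /andP[/andP[co_nn co_np] /andP[co_pn co_pp]].
move=> rAB rAB'; case: (rAB) (rAB') => An Bp injAB surjAB liftAB.
case=> An' Bp' injAB' surjAB' liftAB'; split.
- by rewrite pair_exprE /= exprM An expr1n mulnC exprM An' expr1n.
- by rewrite pair_exprE /= exprM Bp expr1n mulnC exprM Bp' expr1n.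
- move=> i j; rewrite !pair_exprE => -[/injAB[ni pj] /injAB'[n'i p'j]].
  by rewrite !Gauss_dvd // ni pj n'i p'j.
- move=> [x x'] [y y'] [/surjAB[i [j ->]] /surjAB'[i' [j' ->]]].
  exists (chinese n n' i i'), (chinese p p' j j'); rewrite !pair_exprE /=.
  congr (_ * _, _ * _); apply: expr_mod_dvd; try eassumption.
  - by rewrite chinese_modl.
  - by rewrite chinese_modl.
  - by rewrite chinese_modr.
  - by rewrite chinese_modr.
move=> [x x'] [y y']; rewrite !pair_exprE => -[/= xnn xnn'] [ypp ypp'].
have [psi [psiA psiB]] : exists psi : {rmorphism R -> R}, psi A = x /\ psi B = y.
  apply: liftAB.
    exact: (realizing_expr n_gt0 n'_gt0 p_gt0 rAB co_nn co_pn xnn).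
  exact: (realizing_expr p_gt0 p'_gt0 n_gt0 (realizingC rAB) co_pp co_np ypp).
have [psi' [psiA' psiB']] :
    exists psi' : {rmorphism S -> S}, psi' A' = x' /\ psi' B' = y'.
  rewrite mulnC in xnn'; rewrite mulnC in ypp'.
  apply: liftAB'.
    apply: (realizing_expr n'_gt0 n_gt0 p'_gt0 rAB' _ _ xnn');
      by rewrite coprime_sym.
  apply: (realizing_expr p'_gt0 p_gt0 n'_gt0 (realizingC rAB') _ _ ypp');
    by rewrite coprime_sym.
have [h hE] := pair_rmorphism psi psi'.
by exists h; rewrite !hE /= psiA psiB psiA' psiB'.
Qed.

(** * The realizing rings *)

(* No unit is required: the realizing rings are obtained by adjoining one. *)
Record f2alg := F2Alg {
  f2car :> zmodType;
  f2mul : f2car -> f2car -> f2car;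
  f2mulA : associative f2mul;
  f2mulC : commutative f2mul;
  f2mulDl : left_distributive f2mul +%R;
  f2_char2 : forall v : f2car, v + v = 0
}.

(** Booleans serve as F_2: addition is exclusive or, while [*+] uses their coercion to naturals. The
    two agree because [v + v = 0]. *)
Lemma f2_mulrb_add (V : f2alg) (v : V) (c d : bool) :
  v *+ (c + d)%R = v *+ c + v *+ d.
Proof.
by case: c d => [] []; rewrite /= ?addr0 ?add0r // [RHS]f2_char2.
Qed.

Section Unitization.

Variable V : f2alg.

(** The pair [(c, v)] stands for c + v with c in F_2, which explains the product formula below. *)
Definition unitization : Type := (bool * V)%type.

HB.instance Definition _ := GRing.Zmodule.on unitization.

Implicit Types x y : unitization.

Definition unitization_mul x y : unitization :=
  (x.1 && y.1, y.2 *+ x.1 + x.2 *+ y.1 + f2mul x.2 y.2).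

Let f2mulDr (u v w : V) : f2mul u (v + w) = f2mul u v + f2mul u w.
Proof. by rewrite !(f2mulC u) f2mulDl. Qed.

Let f2mul0r (u : V) : f2mul 0 u = 0.
Proof. by apply: (addrI (f2mul 0 u)); rewrite -f2mulDl !addr0. Qed.

Let f2mulZl (u v : V) (c : bool) : f2mul (u *+ c) v = f2mul u v *+ c.
Proof. by case: c; rewrite ?f2mul0r. Qed.

Let f2mulZr (u v : V) (c : bool) : f2mul u (v *+ c) = f2mul u v *+ c.
Proof. by rewrite f2mulC f2mulZl f2mulC. Qed.

Let unitization_mulA : associative unitization_mul.
Proof.
move=> [c u] [d v] [e w]; congr (_, _); first exact: andbA.
rewrite /= !f2mulDl !f2mulDr f2mulA !mulrnDl !f2mulZr !f2mulZl -!mulrnA -!mulnb.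
rewrite [(d * c)%N]mulnC [(e * c)%N]mulnC !addrA.
by rewrite [RHS](ACl (1*2*5*3*6*4*7)).
Qed.

Let unitization_mulC : commutative unitization_mul.
Proof.
move=> [c u] [d v]; congr (_, _); first exact: andbC.
by rewrite /= f2mulC (addrC (v *+ c)).
Qed.

Let unitization_mul1 : left_id ((true, 0) : unitization) unitization_mul.
Proof. by move=> [c u]; congr (_, _); rewrite /= f2mul0r mul0rn !addr0. Qed.

Let unitization_mulDl : left_distributive unitization_mul +%R.
Proof.
move=> [c u] [d v] [e w]; congr (_, _); first exact: andb_addl.
rewrite /= f2mulDl mulrnDl.
by rewrite f2_mulrb_add !addrA [LHS](ACl (1*3*5*2*4*6)).
Qed.

HB.instance Definition _ := GRing.Zmodule_isComPzRing.Build unitization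
  unitization_mulA unitization_mulC unitization_mul1 unitization_mulDl.

(** Lifting thus reduces to writing down additive and multiplicative self-maps of [V], checked by
    cases for the small algebras below. *)
Lemma unitization_rmorphism (f : V -> V) :
    {morph f : u v / u + v} -> {morph f : u v / f2mul u v} ->
  exists psi : {rmorphism unitization -> unitization},
    forall x, psi x = (x.1, f x.2).
Proof.
move=> fD fM; pose h (x : unitization) : unitization := (x.1, f x.2).
have f0 : f 0 = 0 by apply: (addrI (f 0)); rewrite -fD !addr0.
have fN u : f (- u) = - f u by apply: (addrI (f u)); rewrite -fD !subrr.
have fn u (c : bool) : f (u *+ c) = f u *+ c by case: c.
have hB : zmod_morphism h by move=> x y; congr (_, _); rewrite /= fD fN.
have hM : monoid_morphism h.
  split=> [|x y]; congr (_, _); rewrite //= ?f0 //.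
  by rewrite !fD fM !fn.
pose mB := GRing.isZmodMorphism.Build _ _ h hB.
pose mM := GRing.isMonoidMorphism.Build _ _ h hM.
pose H : {rmorphism unitization -> unitization} := HB.pack h mB mM.
by exists H.
Qed.

End Unitization.

Lemma realizing_finite (R : comPzRingType) n p (A B : R) :
    (0 < n)%N -> (0 < p)%N -> A ^+ n = 1 -> B ^+ p = 1 ->
    (forall i j, (i < n)%N -> (j < p)%N -> A ^+ i * B ^+ j = 1 ->
       i = 0%N /\ j = 0%N) ->
    (forall x y, x * y = 1 -> exists i j, x = A ^+ i * B ^+ j) ->
    (forall x y, x ^+ n = 1 -> y ^+ p = 1 ->
       exists psi : {rmorphism R -> R}, psi A = x /\ psi B = y) ->
  realizing n p A B.
Proof.
move=> n_gt0 p_gt0 An Bp injAB surjAB liftAB; split=> // i j.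
rewrite -(expr_mod i An) -(expr_mod j Bp) /dvdn => /injAB.
by rewrite !ltn_mod => /(_ n_gt0 p_gt0) [-> ->].
Qed.

(** Zero product: adjoining one gives F_2[x] / (x^2). *)
Definition c2_alg : f2alg.
Proof.
by refine (@F2Alg bool (fun _ _ => false) _ _ _ _) => -[].
Defined.

(** Zero product on the span of x, y: adjoining one gives F_2[x, y] modulo the square of the ideal
    (x, y). *)
Definition c22_alg : f2alg.
Proof.
by refine (@F2Alg (bool * bool)%type (fun _ _ => (false, false)) _ _ _ _)
  => -[[] []].
Defined.

(* The span of [x], [x^2] in F_2[x] / (x^3). *)
Definition c4_alg : f2alg.
Proof.
by refine (@F2Alg (bool * bool)%type (fun u v => (false, u.1 && v.1)) _ _ _ _);
  do ?case=> [[] []].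
Defined.

(* The span of [x], [x^2], [y] in F_2[x, y] / (x^3, x y, y^2). *)
Definition c42_alg : f2alg.
Proof.
by refine (@F2Alg (bool * bool * bool)%type
  (fun u v => (false, u.1.1 && v.1.1, false)) _ _ _ _);
  do ?case=> [[[] []] []].
Defined.

(* The field F_4, in the basis [w], [w^2] with [1 + w + w^2 = 0]. *)
Definition c3_alg : f2alg.
Proof.
by refine (@F2Alg (bool * bool)%type
  (fun u v => let z := (u.1 && v.2) (+) (u.2 && v.1) in
     (z (+) (u.2 && v.2), z (+) (u.1 && v.1))) _ _ _ _);
  do ?case=> [[] []].
Defined.

Lemma realizing_c2 : realizing 2 1 ((true, true) : unitization c2_alg) 1.
Proof.
apply: realizing_finite => //.
- by move=> [|[|//]] [|//] _ _.
- by move=> [[] []] [[] []] // _; [exists 1%N, 0%N | exists 0%N, 0%N].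
move=> [[] v] y // _; rewrite expr1 => ->.
have [||psi psiE] := @unitization_rmorphism c2_alg (fun u => v *+ u).
- by case: v => [] [] [].
- by case: v => [] [] [].
by exists psi; rewrite rmorph1 psiE.
Qed.

Lemma realizing_c22 : realizing 2 2
  ((true, (true, false)) : unitization c22_alg) (true, (false, true)).
Proof.
apply: realizing_finite => //.
- by move=> [|[|//]] [|[|//]] _ _.
- by move=> [[] [[] []]] [[] [[] []]] // _;
    [exists 1%N, 1%N | exists 1%N, 0%N | exists 0%N, 1%N | exists 0%N, 0%N].
move=> [[] v] [[] w] // _ _.
have [||psi psiE] :=
  @unitization_rmorphism c22_alg (fun u => v *+ u.1 + w *+ u.2).
- by case: v w => [[] []] [[] []] [[] []] [[] []].
- by case: v w => [[] []] [[] []] [[] []] [[] []].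
by exists psi; rewrite !psiE /= !mulr0n addr0 add0r.
Qed.

Lemma realizing_c4 : realizing 4 1 ((true, (true, false)) : unitization c4_alg) 1.
Proof.
apply: realizing_finite => //.
- by move=> [|[|[|[|//]]]] [|//] _ _.
- by move=> [[] [[] []]] [[] [[] []]] // _;
    [exists 3%N, 0%N | exists 1%N, 0%N | exists 2%N, 0%N | exists 0%N, 0%N].
move=> [[] v] y // _; rewrite expr1 => ->.
(* The substitution x |-> v, hence x^2 |-> v^2. *)
have [||psi psiE] :=
  @unitization_rmorphism c4_alg (fun u => v *+ u.1 + f2mul v v *+ u.2).
- by case: v => [[] []] [[] []] [[] []].
- by case: v => [[] []] [[] []] [[] []].
by exists psi; rewrite rmorph1 psiE /= mulr0n addr0.
Qed.

Lemma realizing_c42 : realizing 4 2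
  ((true, (true, false, false)) : unitization c42_alg) (true, (false, false, true)).
Proof.
apply: realizing_finite => //.
- by move=> [|[|[|[|//]]]] [|[|//]] _ _.
- move=> [[] [[[] []] []]] [[] y] // _;
    [exists 3%N, 1%N | exists 3%N, 0%N | exists 1%N, 1%N | exists 1%N, 0%N
    |exists 2%N, 1%N | exists 2%N, 0%N | exists 0%N, 1%N | exists 0%N, 0%N] => //.
move=> [[] v] [[] [[w1 w2] w3]] // _ y2.
(* As (1 + w)^2 = 1, [w] has square 0 and so no x-coordinate. It then annihilates the whole algebra,
   and x |-> v, y |-> w respects x y = y^2 = 0. *)
have {y2 w1} -> : w1 = false by case: w1 w2 w3 y2 => [] [] [].
set w : c42_alg := (false, w2, w3).
have [||psi psiE] := @unitization_rmorphism c42_alg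
    (fun u => v *+ u.1.1 + f2mul v v *+ u.1.2 + w *+ u.2).
- move=> [[a b] c] [[a' b'] c'].
  rewrite -[LHS]/(v *+ (a + a')%R + f2mul v v *+ (b + b')%R + w *+ (c + c')%R).
  by rewrite !f2_mulrb_add !addrA [LHS](ACl (1*3*5*2*4*6)).
- by case: v => [[[] ?] ?] [[[] []] []] [[[] []] []].
by exists psi; rewrite !psiE /= !mulr0n !addr0 !add0r.
Qed.

(** F_4 already has an identity, so adjoining one gives F_2 x F_4, whose unit group is C_3. The
    condition [x ^+ 3 = 1] excludes the identity of F_4 as the image of w^2. *)
Lemma realizing_c3 : realizing 3 1 ((true, (false, true)) : unitization c3_alg) 1.
Proof.
apply: realizing_finite => //.
- by move=> [|[|[|//]]] [|//] _ _.
- by move=> [[] [[] []]] [[] [[] []]] // _;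
    [exists 2%N, 0%N | exists 1%N, 0%N | exists 0%N, 0%N].
move=> [[] v] y // v3; rewrite expr1 => ->.
have [||psi psiE] :=
  @unitization_rmorphism c3_alg (fun u => v *+ u.2 + f2mul v v *+ u.1).
- by case: v v3 => [[] []] // _ [[] []] [[] []].
- by case: v v3 => [[] []] // _ [[] []] [[] []].
by exists psi; rewrite rmorph1 psiE /= mulr0n addr0.
Qed.

(** The 2-part and the 3-part of C_n x C_p are realized separately and combined by
    [realizing_pair]. *)
Lemma realizing_exists p n :
    ((p = 2 /\ n %| 12) \/ (p = 3 /\ n %| 4))%N ->
  exists (R : comPzRingType) (A B : R), realizing n p A B.
Proof.
case=> -[->]; rewrite dvdn_divisors // !inE.
  have [r12 r31] := (realizingC realizing_c2, realizing_c3).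
  case/or4P=> [|||/or3P[]] /eqP->.
  - by do 3 eexists; exact: r12.
  - by do 3 eexists; exact: realizing_c22.
  - by do 3 eexists; exact: (realizing_pair _ _ _ _ _ r12 r31).
  - by do 3 eexists; exact: realizing_c42.
  - by do 3 eexists; exact: (realizing_pair _ _ _ _ _ realizing_c22 r31).
  by do 3 eexists; exact: (realizing_pair _ _ _ _ _ realizing_c42 r31).
have r13 := realizingC realizing_c3.
case/or3P=> /eqP->; do 3 eexists.
- exact: r13.
- exact: (realizing_pair _ _ _ _ _ realizing_c2 r13).
exact: (realizing_pair _ _ _ _ _ realizing_c4 r13).
Qed.

Local Close Scope ring_scope.
Local Close Scope group_scope.

Theorem theorem4p3 (p n : nat) (p_prime : prime p) (n_gt0 : 0 < n)
    (aT rT : finGroupType) (P : {group aT}) (N : {group rT})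
    (cycP : cyclic P) (oP : #|P| = p) (cycN : cyclic N) (oN : #|N| = n)
    (to : groupAction P N) :
  fully_realizable (sdprod_by to) <->
  abelian [set: sdprod_by to] /\
  ((p = 2 /\ n %| 12) \/ (p = 3 /\ n %| 4)).
Proof.
have [a [b [k gen_ab]]] := sdprod_by_split_metacyclic to cycP oP cycN oN.
have p_gt0 := prime_gt0 p_prime.
split=> [[R [phi [phi_bij phi_lift]]] | [/centsP cG np]].
  have [aba np] := realized_necessary n_gt0 p_prime gen_ab phi_bij phi_lift.
  split=> //; apply/centsP=> g _ h _.
  exact: ((split_metacyclic_abelian gen_ab).2 aba).
have aba : (a ^ b = a)%g.
  by apply/(split_metacyclic_abelian gen_ab) => g h; apply: cG; rewrite inE.
have [R [A [B rAB]]] := realizing_exists np.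
exact: realizing_fully_realizable n_gt0 p_gt0 gen_ab aba rAB.
Qed.
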